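(* Let $n$ and $k$ be integers with $k\ge 2$ and $n\ge 3k+1$. Then the mutual-visibility number of the bipartite Kneser graph $H(n,k)$ satisfies $$\mu(H(n,k))\ge\max\left\{\binom{n}{k},\; 2\binom{n}{k}-2\,C(n,n-k,2k)\right\}.$$
   Context: Bipartite Kneser graph: for $n>2k$, $H(n,k)$ has as vertices the $k$-element subsets and the $(n-k)$-element subsets of $[n]=\{1,\dots,n\}$; two distinct vertices are adjacent if and only if one of the represented sets is a subset of the other. Mutual-visibility: Let $G$ be a connected graph and $\mathcal X\subseteq V(G)$. Two vertices $u,v\in V(G)$ are $\mathcal X$-visible if there is a shortest $u,v$-path $P$ in $G$ with no internal vertex in $\mathcal X$, i.e. $V(P)\cap\mathcal X\subseteq\{u,v\}$. The set $\mathcal X$ is a mutual-visibility set if any two vertices of $\mathcal X$ are $\mathcal X$-visible. The mutual-visibility number $\mu(G)$ is the largest cardinality of a mutual-visibility set in $G$. Covering number: For positive integers $n\ge m\ge t$, $C(n,m,t)$ is the minimum number of blocks in a collection $\mathcal B$ of $m$-element subsets (blocks) of an $n$-element set $X$ such that every $t$-element subset of $X$ is contained in at least one block of $\mathcal B$. *)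

(* Defs.v *)
From mathcomp Require Import all_boot.
From mathcomp Require Import boolp.

Set Implicit Arguments.
Unset Strict Implicit.
Unset Printing Implicit Defensive.

Record sgraph := SGraph {
  vertex :> finType;
  adj : rel vertex;
  adj_sym : symmetric adj;
  adj_irrefl : irreflexive adj }.

Section MutualVisibility.

Variable G : sgraph.
Implicit Types (u v : G) (p q : seq G) (X : {set G}).

(* As in path.v, the path is the sequence u :: p, so its length is size p. *)
Definition is_path u v p : Prop :=
  [/\ path (@adj G) u p, last u p = v & uniq (u :: p)].

Definition shortest_path u v p : Prop :=
  is_path u v p /\ forall q, is_path u v q -> size p <= size q.

Definition visible X u v : Prop :=
  exists2 p, shortest_path u v p &
    forall w, w \in u :: p -> w \in X -> w = u \/ w = v.

Definition mutual_visibility_set X : Prop :=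
  {in X &, forall u v, visible X u v}.

Definition mutual_visibility_number : nat :=
  \max_(X : {set G} | `[< mutual_visibility_set X >]) #|X|.

End MutualVisibility.

Section BipartiteKneser.

Variables n k : nat.

Definition kneser_vertex : finType :=
  {A : {set 'I_n} | (#|A| == k) || (#|A| == n - k)}.

Definition kneser_adj : rel kneser_vertex := fun A B =>
  (A != B) && ((val A \subset val B) || (val B \subset val A)).

Lemma kneser_adj_sym : symmetric kneser_adj.
Proof. by move=> A B; rewrite /kneser_adj eq_sym orbC. Qed.

Lemma kneser_adj_irrefl : irreflexive kneser_adj.
Proof. by move=> A; rewrite /kneser_adj eqxx. Qed.

(* This is the bipartite Kneser graph H(n, k) when 2 * k < n. *)
Definition bipartite_kneser : sgraph :=
  SGraph kneser_adj_sym kneser_adj_irrefl.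

End BipartiteKneser.

Definition is_covering (n m t : nat) (F : {set {set 'I_n}}) : Prop :=
  (forall b, b \in F -> #|b| = m) /\
  (forall T : {set 'I_n}, #|T| = t -> exists2 b, b \in F & T \subset b).

(* The family of all m-subsets is a covering whenever t <= m <= n, so this is
   a genuine minimum in that range. *)
Definition covering_number (n m t : nat) : nat :=
  #|[arg min_(F < [set b : {set 'I_n} | #|b| == m]
               | `[< is_covering m t F >]) #|F| ]|.

(* Main.v *)
Require Import Defs.
From mathcomp Require Import all_boot.
From mathcomp Require Import boolp zify.

Set Implicit Arguments.
Unset Strict Implicit.
Unset Printing Implicit Defensive.

(** Call a vertex of H(n, k) small if it is a k-set and large if it is an
    (n - k)-set. These are the two sides of a bipartition ([adj_small]), and
    complementation is an automorphism exchanging them ([adj_compl]).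

    Let F be a family of (n - k)-sets covering all 2k-sets. Two small vertices
    have a union of at most 2k elements, so they have a common neighbour in F
    ([covering_common_neighbour]). By complementation, two large vertices have
    a common neighbour whose complement is in F. For a small A and a large B
    with A not contained in B, the distance is odd and not 1, and it is exactly
    3: choose D in F containing A and ~B, both k-sets; since ~D is also a
    k-set, there is D' in F containing ~B and ~D, and then A - D - ~D' - B is a
    path ([covering_two_hubs]). All these paths are shortest, and their inner
    vertices lie in the set of hubs, made of the members of F and their
    complements. Hence the set of vertices that are not hubs is a
    mutual-visibility set ([mutual_visibility_setC_hubs]), and it misses at
    most 2|F| of the 2 'C(n, k) vertices; a smallest F gives the second bound.

    For the first bound, take for F all (n - k)-sets: the 'C(n, k) small
    vertices see each other through large ones
    ([mutual_visibility_set_small]). *)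

(** * Visibility along paths of length at most three *)

Section ShortPaths.

Variable G : sgraph.
Implicit Types (u v w : G) (X : {set G}).

Lemma visible_refl X u : visible X u u.
Proof.
exists [::]; first by split=> // q _.
by move=> w; rewrite inE => /eqP ->; left.
Qed.

Lemma visible_adj X u v : adj u v -> visible X u v.
Proof.
move=> uv; have uNv : u != v by apply: contraTneq uv => ->; rewrite adj_irrefl.
exists [:: v].
  split=> [|[|x q] [_ /= uv' _] //]; last by rewrite uv' eqxx in uNv.
  by split; rewrite //= ?uv // inE uNv.
by move=> w; rewrite !inE => /orP[]/eqP ->; [left | right].
Qed.

Lemma visible_common_neighbour X u v w :
  u != v -> ~~ adj u v -> adj u w -> adj w v -> w \notin X -> visible X u v.
Proof.
move=> uNv uv uw wv wX.
have uNw : u != w by apply: contraTneq uw => ->; rewrite adj_irrefl.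
have wNv : w != v by apply: contraTneq wv => ->; rewrite adj_irrefl.
exists [:: w; v].
  split; first by split; rewrite //= ?uw ?wv // !inE negb_or uNw uNv wNv.
  case=> [|x [|y q]] [/= pq lq _] //; first by rewrite lq eqxx in uNv.
  by move: pq; rewrite lq andbT (negPf uv).
move=> x; rewrite !inE => /or3P[]/eqP -> xX; [by left| |by right].
by rewrite xX in wX.
Qed.

(** The parity argument that excludes paths of length 2 between vertices of
    different colours in a bipartite graph. *)
Lemma colour_path (c : pred G) u p :
  (forall x y, adj x y -> c y = ~~ c x) ->
  path (@adj G) u p -> c (last u p) = odd (size p) (+) c u.
Proof.
move=> cP; elim: p u => //= x p IHp u /andP[ux xp].
by rewrite IHp // (cP _ _ ux); case: (odd _) (c u) => [] [].
Qed.

(** In a bipartite graph a path of length 3 between nonadjacent vertices is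
    shortest. That the walk is a path is automatic: [u = w2] or
    [w1 = v] would make [u] and [v] adjacent, and [u] and [v] have different
    colours. *)
Lemma visible_two_hubs (c : pred G) X u v w1 w2 :
  (forall x y, adj x y -> c y = ~~ c x) -> ~~ adj u v ->
  adj u w1 -> adj w1 w2 -> adj w2 v -> w1 \notin X -> w2 \notin X ->
  visible X u v.
Proof.
move=> cP uv a1 a2 a3 X1 X2.
have p3 : path (@adj G) u [:: w1; w2; v] by rewrite /= a1 a2 a3.
have cuv : c v = ~~ c u := colour_path cP p3.
have uNv : u != v by apply: contra_eqN cuv => /eqP ->; case: (c v).
have adjN x y : adj x y -> x != y by apply: contraTneq => ->; rewrite adj_irrefl.
have uNw2 : u != w2 by apply: contraNneq uv => ->.
have w1Nv : w1 != v by apply: contraNneq uv => <-.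
exists [:: w1; w2; v].
  split.
    split=> //=; rewrite !inE !negb_or uNw2 uNv w1Nv.
    by rewrite !adjN.
  move=> q [pq lq _]; have := colour_path cP pq; rewrite lq cuv.
  case: q pq lq => [|x [|y [|z q]]] //= pq lq; try by case: (c u).
  by move: pq; rewrite lq andbT (negPf uv).
move=> x; rewrite !inE => /or4P[]/eqP -> xX; [by left| | |by right].
  by rewrite xX in X1.
by rewrite xX in X2.
Qed.

Lemma leq_mutual_visibility_number X :
  mutual_visibility_set X -> #|X| <= mutual_visibility_number G.
Proof.
by move=> /asboolP mX; rewrite /mutual_visibility_number (bigmax_sup X).
Qed.

End ShortPaths.

(** * Covering families *)

Section Coverings.

Variable n : nat.
Implicit Types (A B T : {set 'I_n}) (F : {set {set 'I_n}}).

Lemma subset_extend T t :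
  #|T| <= t <= n -> exists2 A : {set 'I_n}, T \subset A & #|A| = t.
Proof.
elim: t => [|t IHt] /andP[Tt tn].
  by exists T => //; apply/eqP; rewrite -leqn0.
move: Tt; rewrite leq_eqVlt => /orP[/eqP <-|Tt]; first by exists T.
have [A TA cA] : exists2 A : {set 'I_n}, T \subset A & #|A| = t.
  by apply: IHt; rewrite -ltnS Tt ltnW.
have /card_gt0P[x] : 0 < #|~: A| by have := cardsC A; rewrite card_ord; lia.
rewrite inE => xA; exists (x |: A); last by rewrite cardsU1 xA cA.
by rewrite (subset_trans TA) // subsetUr.
Qed.

Lemma covering_small m t F T :
  t <= n -> is_covering m t F -> #|T| <= t -> exists2 b, b \in F & T \subset b.
Proof.
move=> tn [_ covF] Tt.
have [A TA cA] : exists2 A : {set 'I_n}, T \subset A & #|A| = t.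
  by apply: subset_extend; rewrite Tt.
by have [b bF Ab] := covF A cA; exists b => //; apply: subset_trans Ab.
Qed.

Lemma full_covering m t : t <= m <= n ->
  is_covering m t [set b : {set 'I_n} | #|b| == m].
Proof.
move=> tmn; split=> [b|T cT]; first by rewrite inE => /eqP.
have [b Tb cb] : exists2 b : {set 'I_n}, T \subset b & #|b| = m.
  by apply: subset_extend; rewrite cT.
by exists b; rewrite // inE cb.
Qed.

Lemma covering_number_attained m t : t <= m <= n ->
  exists2 F : {set {set 'I_n}}, is_covering m t F & #|F| = covering_number n m t.
Proof.
move=> /full_covering /asboolP fullP; rewrite /covering_number.
by case: arg_minnP => // F /asboolP covF _; exists F.
Qed.

End Coverings.

(** * Hubs in the bipartite Kneser graph *)

Section Kneser.

Variables n k : nat.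
Hypothesis hn : 3 * k + 1 <= n.

Local Notation H := (bipartite_kneser n k).
Implicit Types (u v w : H) (A B T : {set 'I_n}) (F : {set {set 'I_n}}).

Definition small u := #|val u| == k.

Lemma card_small u : small u -> #|val u| = k.
Proof. by move/eqP. Qed.

Lemma card_large u : ~~ small u -> #|val u| = n - k.
Proof. by case/orP: (valP u) => /eqP // c /negP[]; apply/eqP. Qed.

Lemma small_neq_large : n - k != k.
Proof. by apply/eqP; lia. Qed.

Lemma card_setC_vertex u : #|~: val u| = if small u then n - k else k.
Proof.
rewrite cardsCs setCK card_ord; case: ifP => [/card_small ->//|/negbT].
by move/card_large ->; lia.
Qed.

Lemma vertexC u : (#|~: val u| == k) || (#|~: val u| == n - k).
Proof. by rewrite card_setC_vertex; case: ifP; rewrite eqxx ?orbT. Qed.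

Definition compl u : H := Sub (~: val u) (vertexC u).

Lemma val_compl u : val (compl u) = ~: val u. Proof. by []. Qed.

Lemma complK : involutive compl.
Proof. by move=> u; apply: val_inj; rewrite !val_compl setCK. Qed.

Lemma small_compl u : small (compl u) = ~~ small u.
Proof.
rewrite {1}/small val_compl card_setC_vertex.
by case: (small u); rewrite ?eqxx // (negPf small_neq_large).
Qed.

Lemma adj_compl u v : adj (compl u) (compl v) = adj u v.
Proof.
rewrite /= /kneser_adj (inj_eq (inv_inj complK)) !val_compl !setCS.
by rewrite orbC.
Qed.

Lemma adj_small u v : adj u v -> small v = ~~ small u.
Proof.
case/andP=> uNv uv.
suff cuv : #|val u| != #|val v|.
  move: cuv; case: (boolP (small u)) (boolP (small v)) => su [] sv //.
    by rewrite !card_small ?eqxx.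
  by rewrite !card_large ?eqxx.
apply: contra uNv => /eqP cuv; apply/eqP/val_inj/eqP.
by case/orP: uv => s; [|rewrite eq_sym]; rewrite eqEcard s cuv leqnn.
Qed.

Section Covering.

Variable F : {set {set 'I_n}}.
Hypothesis covF : is_covering (n - k) (2 * k) F.

Lemma large_in_covering w : val w \in F -> ~~ small w.
Proof.
by case: covF => cF _ /cF cw; rewrite /small cw small_neq_large.
Qed.

Lemma covering_common_neighbour u v : small u -> small v ->
  exists w, [/\ val w \in F, adj u w & adj v w].
Proof.
move=> su sv; have le2k : #|val u :|: val v| <= 2 * k.
  apply: leq_trans (leq_card_setU _ _) _.
  by rewrite !card_small // mul2n addnn.
have [b bF] : exists2 b : {set 'I_n}, b \in F & val u :|: val v \subset b.
  by apply: covering_small covF le2k; lia.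
rewrite subUset => /andP[ub vb].
have vtx_b : (#|b| == k) || (#|b| == n - k).
  by case: covF => /(_ b bF) -> _; rewrite eqxx orbT.
pose w : H := Sub b vtx_b.
have wF : val w \in F by [].
have adjw x : small x -> val x \subset b -> adj x w.
  move=> sx xb; rewrite /= /kneser_adj xb andbT.
  by apply: contraTneq sx => ->; apply: large_in_covering.
by exists w; split; rewrite ?adjw.
Qed.

(** The second application of the covering property is to [~: val v] and
    [~: val w1]; returning to [w1] and [v] by complementation turns the hub
    found there into the complement of a member of the family. *)
Lemma covering_two_hubs u v : small u -> ~~ small v ->
  exists w1 w2, [/\ val w1 \in F, val (compl w2) \in F,
                    adj u w1, adj w1 w2 & adj w2 v].
Proof.
move=> su; rewrite -small_compl => sv.
have [w1 [w1F uw1 _]] := covering_common_neighbour su sv.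
have sw1 : small (compl w1) by rewrite small_compl large_in_covering.
have [w2 [w2F vw2 w1w2]] := covering_common_neighbour sv sw1.
exists w1, (compl w2); rewrite complK; split=> //.
  by rewrite -adj_compl complK.
by rewrite adj_sym -adj_compl complK.
Qed.

Definition hubs : {set H} := [set w | (val w \in F) || (val (compl w) \in F)].

Lemma mutual_visibility_setC_hubs : mutual_visibility_set (~: hubs).
Proof.
have hub w : val w \in F -> w \notin ~: hubs by rewrite !inE negbK => ->.
have hubC w : val (compl w) \in F -> w \notin ~: hubs.
  by rewrite !inE negbK => ->; rewrite orbT.
move=> u v _ _.
have [->|uNv] := eqVneq u v; first exact: visible_refl.
have [uv|uv] := boolP (adj u v); first exact: visible_adj.
case: (boolP (small u)) (boolP (small v)) => su [] sv.
- have [w [wF uw vw]] := covering_common_neighbour su sv.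
  by apply: (visible_common_neighbour uNv uv uw); rewrite 1?adj_sym ?hub.
- have [w1 [w2 [w1F w2F a1 a2 a3]]] := covering_two_hubs su sv.
  exact: visible_two_hubs adj_small uv a1 a2 a3 (hub _ w1F) (hubC _ w2F).
- have [w1 [w2 [w1F w2F a1 a2 a3]]] := covering_two_hubs sv su.
  rewrite adj_sym in a1; rewrite adj_sym in a2; rewrite adj_sym in a3.
  exact: visible_two_hubs adj_small uv a3 a2 a1 (hubC _ w2F) (hub _ w1F).
- rewrite -small_compl in su; rewrite -small_compl in sv.
  have [w [wF uw vw]] := covering_common_neighbour su sv.
  apply: (visible_common_neighbour uNv uv (w := compl w)).
  + by rewrite -adj_compl complK.
  + by rewrite adj_sym -adj_compl complK.
  + by rewrite hubC ?complK.
Qed.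

Lemma card_hubs : #|hubs| <= 2 * #|F|.
Proof.
have -> : hubs = val @^-1: F :|: (val \o compl) @^-1: F.
  by apply/setP => w; rewrite !inE.
rewrite mul2n -addnn; apply: leq_trans (leq_card_setU _ _) _.
have preimF (f : H -> {set 'I_n}) : injective f -> #|f @^-1: F| <= #|F|.
  move=> fI; rewrite -(card_imset _ fI) subset_leq_card //.
  by apply/subsetP => _ /imsetP[x xF ->]; rewrite inE in xF.
apply: leq_add; apply: preimF; first exact: val_inj.
exact: inj_comp val_inj (inv_inj complK).
Qed.

End Covering.

(** The family of all (n - k)-sets is a covering whose members are large, so
    the common neighbours it provides avoid the small vertices. *)
Lemma mutual_visibility_set_small : mutual_visibility_set [set u | small u].
Proof.
have covF : is_covering (n - k) (2 * k) [set b : {set 'I_n} | #|b| == n - k].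
  by apply: full_covering; lia.
move=> u v; rewrite !inE => su sv.
have [->|uNv] := eqVneq u v; first exact: visible_refl.
have [w [wF uw vw]] := covering_common_neighbour covF su sv.
apply: (visible_common_neighbour uNv _ uw); rewrite 1?adj_sym //.
  by apply/negP => /adj_small; rewrite su sv.
by rewrite inE (large_in_covering covF).
Qed.

Lemma card_small_vertices : #|[set u | small u]| = 'C(n, k).
Proof.
have := card_draws 'I_n k; rewrite card_ord => <-.
rewrite -(card_imset _ val_inj); apply: eq_card => A; rewrite inE; apply/imsetP/idP => [[u su ->]|cA].
  by rewrite inE in su.
have vA : (#|A| == k) || (#|A| == n - k) by rewrite cA.
by exists (Sub A vA) => //; rewrite inE.
Qed.

(** Complementation is a bijection between the two sides. *)
Lemma card_vertices : #|H| = 2 * 'C(n, k).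
Proof.
rewrite -cardsT -(setUCr [set u | small u]) cardsU setICr cards0 subn0.
suff -> : ~: [set u | small u] = compl @: [set u | small u].
  by rewrite card_imset ?card_small_vertices; [lia | apply: inv_inj complK].
apply/setP => u; rewrite !inE -small_compl -{2}(complK u).
by rewrite (mem_imset _ _ (inv_inj complK)) inE.
Qed.

End Kneser.

Theorem proposition9 (n k : nat) (hk : 2 <= k) (hn : 3 * k + 1 <= n) :
  maxn 'C(n, k) (2 * 'C(n, k) - 2 * covering_number n (n - k) (2 * k))
    <= mutual_visibility_number (bipartite_kneser n k).
Proof.
rewrite geq_max; apply/andP; split.
  rewrite -card_small_vertices.
  exact: leq_mutual_visibility_number (mutual_visibility_set_small hn).
have [F covF <-] : exists2 F : {set {set 'I_n}},
    is_covering (n - k) (2 * k) F & #|F| = covering_number n (n - k) (2 * k).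
  by apply: covering_number_attained; lia.
apply: leq_trans (leq_mutual_visibility_number
                    (mutual_visibility_setC_hubs (hn := hn) covF)).
rewrite -(card_vertices hn) -(cardsC (hubs hn F)).
by rewrite leq_subLR leq_add2r card_hubs.
Qed.
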